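(* Let $\alpha\ge 1$ be an integer and let $a_{n,2\alpha+1}$ denote the heat invariants of the round unit sphere $S^{2\alpha+1}$, i.e. the coefficients in the asymptotic expansion $\sum_{k=0}^\infty \mu_{k}\,e^{-t\,k(k+2\alpha)}\sim\sum_{n\ge 0}a_{n,2\alpha+1}t^{\,n-\frac{2\alpha+1}{2}}$ as $t\to0+$, where $\mu_0=1$ and $\mu_k=\frac{(2k+2\alpha)(k+2\alpha-1)!}{k!\,(2\alpha)!}$ for $k\ge1$. Define constants $K_s^{\alpha}$ by $$\prod_{\beta=0}^{\alpha-1}(z^2-\beta^2)=\sum_{s=1}^{\alpha}K_s^{\alpha}z^{2s}.$$ Then for every integer $n\ge 0$, $$a_{n,2\alpha+1}=\sum_{s=1}^{\alpha}\frac{\alpha^{2n-2\alpha+2s}\,\Gamma(s+\frac12)\,K_s^{\alpha}}{(n-\alpha+s)!\,(2\alpha)!},$$ with the convention $1/m!=0$ for negative integers $m$. In particular, $$a_{n,5}=\frac{4^{n-3}(6-n)\sqrt{\pi}}{3\cdot n!},\qquad a_{n,7}=\frac{3^{2n-6}(16n^2-286n+1215)\sqrt{\pi}}{640\cdot n!}.$$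
   Context: The multiplicities $\mu_k$ and eigenvalues $k(k+2\alpha)$ are those of the nonnegative Laplace–Beltrami operator on the sphere of curvature $+1$; the sum on the left of the expansion is the heat trace. *)

(* Defs.v *)
From HB Require Import structures.
From mathcomp Require Import all_boot all_order all_algebra.
From mathcomp Require Import all_classical all_reals all_analysis.
Set Implicit Arguments.
Unset Strict Implicit.
Unset Printing Implicit Defensive.
Import Order.TTheory GRing.Theory Num.Theory.
Import numFieldNormedType.Exports.
Local Open Scope classical_set_scope.
Local Open Scope ring_scope.

(* The truncated subtraction is only reached for k >= 1, where it is exact. *)
Definition sphere_mult (R : realType) (alpha k : nat) : R :=
  if k == 0%N then 1
  else (2 * k + 2 * alpha)%:R * ((k + 2 * alpha - 1)`!)%:R
       / ((k`!)%:R * ((2 * alpha)`!)%:R).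

Definition heat_trace (R : realType) (alpha : nat) (t : R) : R :=
  limn (series (fun k : nat =>
    sphere_mult R alpha k * expR (- (t * (k * (k + 2 * alpha))%:R)))).

Definition heat_scale (R : realType) (alpha n : nat) (t : R) : R :=
  t `^ (n%:R - (2 * alpha + 1)%:R / 2).

(* Asymptotic expansion in the sense of Poincare: for every N, the error after
   the term of index N is negligible with respect to that term's power of t. *)
Definition heat_invariants (R : realType) (alpha : nat) (a : nat -> R) : Prop :=
  forall N : nat,
    (fun t : R => heat_trace alpha t
       - \sum_(0 <= n < N.+1) a n * heat_scale alpha n t)
    =o_ ((0 : R)^'+) (fun t : R => heat_scale alpha N t).

Definition Gamma (R : realType) (x : R) : R :=
  \int[@lebesgue_measure R]_(u in `]0, +oo[) (u `^ (x - 1) * expR (- u)).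

Definition inv_fact (R : realType) (m : int) : R :=
  if m is Posz k then ((k`!)%:R)^-1 else 0.

(* Main.v *)
(* Put [z = k + alpha].  Then [k (k + 2 alpha) = z^2 - alpha^2] and
   [(2 alpha)! mu_k = 2 P(z)] with [P(z) = \prod_(b < alpha) (z^2 - b^2)],
   so the heat trace is [exp(alpha^2 t) / (2 alpha)!] times the sum of
   [P(z) exp(-t z^2)] over all integers [z].  The trapezoidal sum with step
   [h = sqrt t] of a function [x^(2s) exp(-x^2)] equals its integral
   [Gamma(s + 1/2)] up to any power of [h], and expanding [exp(alpha^2 t)] gives
   the coefficients.

   Trapezoidal sums are handled without Poisson summation: Taylor expansion of a
   primitive, summed over the grid, writes the integral as the trapezoidal sum
   plus powers of [h] times the trapezoidal sums of the derivatives.  Each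
   derivative is itself the derivative of a decaying function, so its integral
   vanishes and induction on the order applies to it. *)
Require Import Defs.
From HB Require Import structures.
From mathcomp Require Import all_boot all_order all_algebra.
From mathcomp Require Import all_classical all_reals all_analysis.
From mathcomp Require Import measurable_realfun zify ring lra.
Import Order.TTheory GRing.Theory Num.Theory.
Import numFieldNormedType.Exports.
Local Open Scope classical_set_scope.
Local Open Scope ring_scope.

(** * Mean value and Taylor estimates *)

Lemma derive_continuous (R : realType) (f df : R -> R) :
  (forall x : R, is_derive x 1 f (df x)) -> continuous f.
Proof.
move=> fdf x; apply: differentiable_continuous; apply/derivable1_diffP.
by have [] := fdf x.
Qed.

Lemma mean_value (R : realType) (f df : R -> R) (a b : R) : a <= b ->
  (forall x : R, is_derive x 1 f (df x)) ->
  exists2 c, a <= c <= b & f b - f a = df c * (b - a).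
Proof.
move=> ab fdf; have [|c] := @MVT_segment _ f df a b ab (fun x _ => fdf x).
  exact/continuous_subspaceT/(derive_continuous _ _ _ fdf).
by rewrite in_itv/= => cab ->; exists c.
Qed.

(** Induction on [n]: the mean value theorem, applied to [F 0] minus its Taylor polynomial, leads to
    the same difference for the shifted sequence, one order lower. The factor [1/n!] of the sharp
    remainder is given up. *)
Lemma taylor_remainder (R : realType) (n : nat) (F : nat -> R -> R)
    (x h B : R) :
  0 <= h -> (forall k (y : R), is_derive y 1 (F k) (F k.+1 y)) ->
  (forall y, x <= y <= x + h -> `|F n y| <= B) ->
  `|F 0 (x + h) - \sum_(k < n) F k x / (k`!)%:R * h ^+ k| <= B * h ^+ n.
Proof.
elim: n F h => [|n IHn] F h h0 dF FB.
  by rewrite big_ord0 subr0 expr0 mulr1 FB// lexx lerDl h0.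
pose T m (G : nat -> R -> R) := \poly_(k < m) (G k x / (k`!)%:R).
have TE m G y : (T m G).[y] = \sum_(k < m) G k x / (k`!)%:R * y ^+ k.
  exact: horner_poly.
have dT : (T n.+1 F)^`() = T n (fun k => F k.+1).
  apply/polyP => i; rewrite coef_deriv !coef_poly ltnS.
  case: ifP => _; last by rewrite mul0rn.
  rewrite factS natrM invfM -mulr_natr.
  have i0 : (i.+1)%:R != 0 :> R by rewrite pnatr_eq0.
  have f0 : (i`!)%:R != 0 :> R by rewrite pnatr_eq0 -lt0n fact_gt0.
  by field; rewrite f0 nat1r i0.
pose g y := F 0 (x + y) - (T n.+1 F).[y].
have dg (y : R) : is_derive y 1 g (F 1 (x + y) - (T n (fun k => F k.+1)).[y]).
  apply: is_deriveB; last by rewrite -dT; exact: is_derive_poly.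
  have dx : is_derive y 1 (fun y : R => x + y) 1.
    rewrite -[X in is_derive _ _ _ X]add0r.
    by apply: is_deriveD; exact: is_derive_id.
  have := @is_derive1_comp R (F 0%N) (fun y => x + y) y _ 1 (dF 0%N (x + y)) dx.
  by rewrite mulr1.
have [c /andP[c0 ch]] := mean_value _ _ _ _ _ h0 dg.
have g0 : g 0 = 0.
  rewrite /g TE addr0 big_ord_recl expr0 mulr1 fact0 divr1 big1 ?addr0 ?subrr//.
  by move=> i _; rewrite lift0 expr0n mulr0.
rewrite g0 !subr0 /g TE => ->; rewrite normrM (ger0_norm h0) TE.
rewrite exprSr mulrA ler_wpM2r//.
have B0 : 0 <= B by apply: le_trans (normr_ge0 _) (FB x _); rewrite lexx lerDl.
apply: (le_trans (IHn (fun k => F k.+1) c c0 (fun k => dF k.+1) _)).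
  move=> y /andP[xy yc]; apply: FB; rewrite xy (le_trans yc)//.
  by rewrite lerD2l.
by rewrite ler_wpM2l// lerXn2r ?nnegrE.
Qed.

(** * Decay and grid sums, measured against the derivative of the arctangent *)

Definition recip1sqr (R : realType) (x : R) : R := (1 + x ^+ 2)^-1.

Lemma oneDsqr_gt0 (R : realType) (x : R) : 0 < 1 + x ^+ 2.
Proof. by rewrite ltr_pwDl// sqr_ge0. Qed.

Lemma recip1sqr_gt0 (R : realType) (x : R) : 0 < recip1sqr R x.
Proof. by rewrite invr_gt0 oneDsqr_gt0. Qed.

Lemma recip1sqr_le1 (R : realType) (x : R) : recip1sqr R x <= 1.
Proof. by rewrite invf_le1 ?oneDsqr_gt0// lerDl sqr_ge0. Qed.

Lemma recip1sqr_near (R : realType) (x y : R) :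
  `|x - y| <= 1 -> recip1sqr R x <= 3 * recip1sqr R y.
Proof.
rewrite ler_norml => /andP[xy1 xy2].
rewrite /recip1sqr ler_pdivlMr ?oneDsqr_gt0// mulrC ler_pdivrMr ?oneDsqr_gt0//.
have d1 : (x - y) ^+ 2 <= 1 by nra.
(* This square gives [y^2 <= 2 x^2 + 2 (x - y)^2 <= 2 x^2 + 2], whence the constant 3. *)
have := sqr_ge0 (2 * x - y); nra.
Qed.

(** Since [h <= 1], each term is at most 3 times the increment of the arctangent over one cell. The
    increments telescope to less than [pi], so the bound is uniform in [x], [h] and [m]. *)
Lemma sum_recip1sqr (R : realType) (h x : R) (m : nat) : 0 < h -> h <= 1 ->
  h * \sum_(i < m) recip1sqr R (x + h * i%:R) <= 3 * pi.
Proof.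
move=> h0 h1.
have step (y : R) : h * recip1sqr R y <= 3 * (atan (y + h) - atan y).
  have yh : y <= y + h by rewrite lerDl ltW.
  have [c /andP[yc cyh] ->] := mean_value _ _ _ _ _ yh (@is_derive1_atan R).
  rewrite [y + h]addrC addrK mulrA mulrC ler_pM2r//; apply: recip1sqr_near.
  by rewrite ler_norml; apply/andP; split; lra.
have : h * \sum_(i < m) recip1sqr R (x + h * i%:R) <=
    3 * (atan (x + h * m%:R) - atan x).
  elim: m => [|m IHm]; first by rewrite big_ord0 !mulr0 addr0 subrr mulr0.
  rewrite big_ord_recr mulrDr /= (le_trans (lerD IHm (step _)))//.
  by rewrite -[m.+1%:R]natr1 (mulrDr h) mulr1 addrA; lra.
move=> /le_trans; apply; rewrite ler_pM2l//.
have := atan_ltpi2 (x + h * m%:R); have := atan_gtNpi2 x; lra.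
Qed.

Definition decaying (R : realType) (f : R -> R) : Prop :=
  exists C, forall x, `|f x| <= C * recip1sqr R x.

(** The integral of [F 1] is written as an increment of [F 0]. Taylor expansion of [F 0] on each
    cell, summed over the grid, yields the grid sum of [F 1] plus terms [h^(j+1) / (j+2)!] times
    grid sums of [F (j+2)]. The induction hypothesis bounds those sums, and the extra power of [h]
    raises the order by one. The last two terms of the bound record the decay at the two ends of the
    grid. *)
Lemma grid_sum_error (R : realType) (N : nat) (F : nat -> R -> R) (B : R) :
  (forall k (x : R), is_derive x 1 (F k) (F k.+1 x)) ->
  (forall k, decaying R (F k.+1)) -> (forall x, `|F 0 x| <= B) ->
  exists2 C, 0 <= C & forall h x m, 0 < h -> h <= 1 ->
    `|h * \sum_(i < m) F 1 (x + h * i%:R) - (F 0 (x + h * m%:R) - F 0 x)|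
      <= C * (h ^+ N + recip1sqr R x + recip1sqr R (x + h * m%:R)).
Proof.
have dec_ge0 (f : R -> R) C : (forall x, `|f x| <= C * recip1sqr R x) -> 0 <= C.
  move=> /(_ 0)/(le_trans (normr_ge0 _)).
  by rewrite pmulr_lge0// recip1sqr_gt0.
have sum_le (f : R -> R) C h x m :
    (forall x, `|f x| <= C * recip1sqr R x) -> 0 < h -> h <= 1 ->
    h * \sum_(i < m) `|f (x + h * i%:R)| <= 3 * pi * C.
  move=> fC h0 h1; have C0 := dec_ge0 _ _ fC.
  rewrite [leRHS]mulrC.
  apply: le_trans (ler_wpM2l C0 (sum_recip1sqr R h x m h0 h1)).
  rewrite mulrCA ler_pM2l// mulr_sumr; apply: ler_sum => i _; exact: fC.
have pi0 := @pi_ge0 R.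
elim: N F B => [|N IHN] F B dF FC FB.
  (* For [N = 0] the bound contains [h^0 = 1], so it suffices that the grid sum and [F 0] are
     bounded. *)
  have [C1 F1] := FC 0; have C10 := dec_ge0 _ _ F1.
  have B0 : 0 <= B by apply: le_trans (FB 0).
  exists (3 * pi * C1 + 2 * B) => [|h x m h0 h1].
    by rewrite addr_ge0// mulr_ge0// mulr_ge0.
  have D0 : 0 <= 3 * pi * C1 + 2 * B.
    by rewrite addr_ge0// mulr_ge0// mulr_ge0.
  apply: (@le_trans _ _ (3 * pi * C1 + 2 * B)); last first.
    rewrite ler_peMr// expr0 -addrA lerDl addr_ge0 ?ltW ?recip1sqr_gt0//.
  apply: (le_trans (ler_normB _ _)); apply: lerD.
    rewrite normrM gtr0_norm//.
    apply: le_trans (sum_le _ _ h x m F1 h0 h1).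
    by rewrite ler_pM2l//; exact: ler_norm_sum.
  apply: (le_trans (ler_normB _ _)); rewrite mulr_natl mulr2n.
  by apply: lerD; exact: FB.
have [C FC'] := choice FC.
have C0 k : 0 <= C k by exact: dec_ge0 (FC' k).
(* The induction hypothesis is used for the sequence starting at [F (j+1)]. This function decays, so
   its increment is absorbed by the two end terms. *)
have /choice[D D0] : forall j, exists D, 0 <= D /\ forall h x m, 0 < h ->
    h <= 1 -> `|h * \sum_(i < m) F j.+2 (x + h * i%:R)| <=
    D * (h ^+ N + recip1sqr R x + recip1sqr R (x + h * m%:R)).
  move=> j.
  have [||x|E E0 HE] := IHN (fun k => F (j.+1 + k)%N) (C j).
  - by move=> k y; rewrite addnS; exact: dF.
  - by move=> k; rewrite addnS; exact: FC.
  - rewrite addn0 (le_trans (FC' j x))// ler_piMr//; exact: recip1sqr_le1.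
  exists (E + C j); split; first exact: addr_ge0.
  move=> h x m h0 h1; have := HE h x m h0 h1; rewrite addn1 addn0.
  set S := h * _; set e := _ + _ + _ => HS.
  rewrite -(subrK (F j.+1 (x + h * m%:R) - F j.+1 x) S).
  apply: (le_trans (ler_normD _ _)); rewrite mulrDl; apply: lerD => //.
  apply: (le_trans (ler_normB _ _)).
  apply: (le_trans (lerD (FC' _ _) (FC' _ _))); rewrite -mulrDr ler_wpM2l//.
  by rewrite /e -addrA [leLHS]addrC lerDr exprn_ge0// ltW.
exists (\sum_(j < N) D j + 9 * pi * C N.+1).
  rewrite addr_ge0 ?sumr_ge0// => [j _|]; first by have [] := D0 j.
  by rewrite !mulr_ge0.
move=> h x m h0 h1; set e := _ + _ + _.
pose p i := x + h * i%:R.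
have pS i : p i.+1 = p i + h by rewrite /p -natr1 mulrDr mulr1 addrA.
(* The factor 3 comes from bounding the derivative of order [N + 2] on the whole cell by the decay
   at its left end. *)
have tay i : `|F 0 (p i.+1) - F 0 (p i) - h * F 1 (p i) -
     \sum_(j < N) F j.+2 (p i) / (j.+2`!)%:R * h ^+ j.+2| <=
    3 * C N.+1 * h ^+ N.+2 * recip1sqr R (p i).
  have := taylor_remainder R N.+2 F (p i) h
    (3 * C N.+1 * recip1sqr R (p i)) (ltW h0) dF.
  rewrite -pS !big_ord_recl /= expr0 expr1 fact0 divr1 mulr1 divr1.
  rewrite [h * F _ _]mulrC opprD addrA opprD addrA [leRHS]mulrAC; apply.
  move=> y /andP[py yp]; apply: (le_trans (FC' _ _)).
  rewrite -(mulrA 3) mulrCA ler_wpM2l// recip1sqr_near//.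
  by move: yp; rewrite pS ler_norml => yp; apply/andP; split; lra.
have tele : \sum_(i < m) (F 0 (p i.+1) - F 0 (p i)) = F 0 (p m) - F 0 (p 0%N).
  rewrite -(big_mkord xpredT (fun i => F 0 (p i.+1) - F 0 (p i))).
  exact: telescope_sumr.
have p0 : p 0%N = x by rewrite /p mulr0 addr0.
(* Summing the remainders costs one power of [h] and another factor [3 * pi]. *)
have : `|\sum_(i < m) (F 0 (p i.+1) - F 0 (p i) - h * F 1 (p i) -
     \sum_(j < N) F j.+2 (p i) / (j.+2`!)%:R * h ^+ j.+2)| <=
    9 * pi * C N.+1 * h ^+ N.+1.
  apply: (le_trans (ler_norm_sum _ _ _)).
  apply: le_trans (ler_sum _ (fun (i : 'I_m) _ => tay i)) _.
  rewrite -mulr_sumr /p.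
  have := ler_wpM2l (C0 N.+1) (sum_recip1sqr R h x m h0 h1).
  set s := \sum_(i < m) _.
  have hN : 0 <= h ^+ N.+1 by rewrite exprn_ge0// ltW.
  by move=> /(ler_wpM2l hN); rewrite (exprS h N.+1); lra.
rewrite 2!sumrB tele p0 -mulr_sumr.
have -> : \sum_(i < m) \sum_(j < N) F j.+2 (p i) / (j.+2`!)%:R * h ^+ j.+2 =
   \sum_(j < N) (h ^+ j.+1 / (j.+2`!)%:R * (h * \sum_(i < m) F j.+2 (p i))).
  rewrite exchange_big; apply: eq_bigr => j _; rewrite !mulr_sumr.
  by apply: eq_bigr => i _; rewrite (exprS _ j.+1); ring.
rewrite /p; set d := F 0 _ - _; set S := h * \sum_(i < m) F 1 _.
set Q := \sum_(j < N) (_ * (h * _)) => H1.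
have HQ : `|Q| <= (\sum_(j < N) D j) * e.
  apply: (le_trans (ler_norm_sum _ _ _)); rewrite mulr_suml.
  apply: ler_sum => j _; have [Dj0 /(_ h x m h0 h1)] := D0 j.
  set T := h * _ => HT; rewrite normrM.
  apply: (@le_trans _ _ (h * `|T|)).
    rewrite ler_wpM2r// normrM ger0_norm ?exprn_ge0 ?(ltW h0)//.
    rewrite ger0_norm ?invr_ge0// exprS -mulrA ler_piMr ?(ltW h0)//.
    rewrite mulr_ile1 ?exprn_ge0 ?invr_ge0 ?(ltW h0)//.
      by rewrite exprn_ile1 ?(ltW h0).
    by rewrite invf_le1 ?ltr0n ?fact_gt0// ler1n fact_gt0.
  apply: (le_trans (ler_wpM2l (ltW h0) HT)); rewrite mulrCA ler_wpM2l//.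
  rewrite /e exprS -!addrA mulrDr lerD2l ler_piMl//.
  by rewrite addr_ge0 ?ltW ?recip1sqr_gt0.
have -> : S - d = - (d - S - Q) - Q by ring.
apply: (le_trans (ler_normB _ _)); rewrite normrN mulrDl addrC lerD//.
apply: (le_trans H1); rewrite ler_wpM2l ?mulr_ge0//.
by rewrite /e -addrA lerDl addr_ge0 ?ltW ?recip1sqr_gt0.
Qed.

(** * Polynomials times the Gaussian: derivatives, decay and primitives *)

Lemma is_derive_gauss_fun (R : realType) (x : R) :
  is_derive x 1 gauss_fun (- (2 * x) * gauss_fun x).
Proof.
have dq : is_derive x 1 (fun x : R => - x ^+ 2) (- (2 * x)).
  have := is_derive_poly (- 'X^2) x.
  rewrite derivN derivXn !hornerE/= mulr_natl.
  by congr is_derive; apply/funext => y; rewrite !hornerE.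
have := @is_derive1_comp R expR (fun x => - x ^+ 2) x _ _ (is_derive_expR _) dq.
by rewrite mulrC.
Qed.

(** The form polynomial times Gaussian is stable under derivation, so the derivatives that
    [grid_sum_error] asks for come from iterating a map on polynomials. *)
Lemma is_derive_poly_gauss (R : realType) (p : {poly R}) (x : R) :
  is_derive x 1 (fun x : R => p.[x] * gauss_fun x)
    ((p^`() - 2 *: ('X * p)).[x] * gauss_fun x).
Proof.
have dp := is_derive_poly p x.
have dg := is_derive_gauss_fun R x.
apply: (is_derive_eq (is_deriveM dp dg)).
rewrite /GRing.scale/= !hornerE/=; ring.
Qed.

(** For [n > 0] this is the [n]-th power of [y / n <= expR (y / n)]; for [n = 0] the constant is
    [0^0 = 1]. *)
Lemma exprn_le_expR (R : realType) (y : R) (n : nat) : 0 <= y ->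
  y ^+ n <= n%:R ^+ n * expR y.
Proof.
case: n => [|n] y0; first by rewrite !expr0 mul1r -expR0 ler_expR.
have n0 : 0 < n.+1%:R :> R by rewrite ltr0n.
have -> : expR y = expR (y / n.+1%:R) ^+ n.+1.
  by rewrite -expRM_natl mulrC divfK// gt_eqF.
rewrite -exprMn lerXn2r ?nnegrE// ?mulr_ge0 ?expR_ge0 ?ler0n//.
by rewrite mulrC -ler_pdivrMr// (le_trans _ (expR_ge1Dx _))// lerDr ler01.
Qed.

(** With [y = 1 + x^2] one has [|x| <= y], so [|x|^n y <= y^(n+1)], which is at most
    [(n+1)^(n+1) exp(y)]. The factor [expR 1] converts [exp(-x^2)] into [exp(-y)]. *)
Lemma decaying_monomial_gauss (R : realType) (n : nat) :
  decaying R (fun x => x ^+ n * gauss_fun x).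
Proof.
exists (n.+1%:R ^+ n.+1 * expR 1) => x.
rewrite ler_pdivlMr ?oneDsqr_gt0// normrM.
rewrite [`|gauss_fun x|]ger0_norm ?gauss_fun_ge0//.
have gE : gauss_fun x = expR 1 / expR (1 + x ^+ 2).
  by rewrite -expRB /gauss_fun opprD addrA subrr add0r.
rewrite gE -mulrA [leLHS]mulrA mulrCA -mulrA mulrCA [leRHS]mulrC.
rewrite mulrCA ler_pM2l ?expR_gt0// mulrAC ler_pdivrMr ?expR_gt0//.
apply: le_trans (exprn_le_expR R (1 + x ^+ 2) n.+1 (ltW (oneDsqr_gt0 R x))).
rewrite [leRHS]exprSr ler_pM2r ?oneDsqr_gt0// normrX.
rewrite lerXn2r ?nnegrE ?(ltW (oneDsqr_gt0 R x))//.
by rewrite ler_norml; apply/andP; split; nra.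
Qed.

Lemma decaying_poly_gauss (R : realType) (p : {poly R}) :
  decaying R (fun x => p.[x] * gauss_fun x).
Proof.
have [C HC] := choice (decaying_monomial_gauss R).
exists (\sum_(i < size p) `|p`_i| * C i) => x.
rewrite horner_coef !mulr_suml (le_trans (ler_norm_sum _ _ _))//.
by apply: ler_sum => i _; rewrite -!mulrA normrM ler_wpM2l.
Qed.

Lemma cvg_recip1sqr (R : realType) : recip1sqr R x @[x --> +oo] --> (0 : R).
Proof.
apply/cvgrPdist_le => e e0; near=> x.
rewrite sub0r normrN gtr0_norm ?recip1sqr_gt0// /recip1sqr.
rewrite -[leRHS]invrK lef_pV2 ?posrE ?oneDsqr_gt0 ?invr_gt0//.
have : e^-1 <= x by near: x; apply: nbhs_pinfty_ge; exact: num_real.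
(* This square gives [x <= 1 + x^2]. *)
by have := sqr_ge0 (x - 2^-1); nra.
Unshelve. all: by end_near. Qed.

Lemma decaying_cvg0 (R : realType) (f : R -> R) :
  decaying R f -> f x @[x --> +oo] --> (0 : R).
Proof.
move=> [C fC].
have Cd0 : C * recip1sqr R x @[x --> +oo] --> (0 : R).
  by rewrite -(mulr0 C); apply: cvgM; [exact: cvg_cst|exact: cvg_recip1sqr].
have C1 : - (C * recip1sqr R x) @[x --> +oo] --> (0 : R).
  by rewrite -oppr0; apply: cvgN.
apply: (squeeze_cvgr _ C1 Cd0).
by near=> x; rewrite -ler_norml fC.
Unshelve. all: by end_near. Qed.

(** The integral over []-oo, x]] is normalised to vanish at 0, which makes it odd because the
    Gaussian is even. *)
Lemma gauss_primitive (R : realType) : exists E : R -> R,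
  [/\ forall x : R, is_derive x 1 E (gauss_fun x),
      forall x, E (- x) = - E x,
      E x @[x --> +oo] --> Num.sqrt pi / 2 &
      exists B : R, forall x, `|E x| <= B].
Proof.
pose mu := @lebesgue_measure R.
have ig (A : set R) : measurable A -> mu.-integrable A (EFin \o gauss_fun).
  by move=> mA; apply: integrableS integrableT_gauss.
pose L x := \int[mu]_(t in `]-oo, x]) gauss_fun t.
have dL (x : R) : is_derive x 1 L (gauss_fun x).
  have xx1 : x < x + 1 by rewrite ltrDl.
  have [//|dLx Lx] := @continuous_FTC1 R gauss_fun -oo%O x (x + 1) xx1 (ig _ _)
    (ltNyr _) (@continuous_gauss_fun R x).
  by apply: DeriveDef => //; rewrite -derive1E.
have LB x : 0 <= L x <= Num.sqrt pi.
  apply/andP; split; first by apply: Rintegral_ge0 => t _; exact: gauss_fun_ge0.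
  rewrite /L /Rintegral -[Num.sqrt pi]/(fine (Num.sqrt pi)%:E) -integralT_gauss.
  apply: fine_le.
  - exact: integrable_fin_num (ig _ _).
  - by rewrite integralT_gauss.
  apply: ge0_subset_integral => //.
  - by apply/measurable_EFinP; exact: measurable_gauss_fun.
  - by move=> t _; rewrite lee_fin gauss_fun_ge0.
have ndL : {homo L : x y / x <= y}.
  move=> x y xy; have [c _ cE] := mean_value R L gauss_fun x y xy dL.
  by rewrite -subr_ge0 cE mulr_ge0 ?gauss_fun_ge0// subr_ge0.
pose l := sup (range L).
have Ll : L x @[x --> +oo] --> l.
  apply: nondecreasing_cvgr => //.
  by exists (Num.sqrt pi) => _ [x _ <-]; case/andP: (LB x).
(* Monotonicity gave only the existence of the limit [l]; the known integral over the half-line now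
   identifies it. *)
have lE : Num.sqrt pi / 2 = l - L 0.
  rewrite -(@Rintegral_ge0_continuous_FTC2y R gauss_fun L 0 l).
  - by rewrite /Rintegral integral0y_gauss.
  - by move=> x _; exact: gauss_fun_ge0.
  - exact/continuous_subspaceT/continuous_gauss_fun.
  - exact: Ll.
  - by move=> x _; have [] := dL x.
  - by apply: cvg_at_right_filter; exact: (derive_continuous _ _ _ dL).
  - by move=> x _; rewrite derive1E; have [] := dL x.
exists (fun x => L x - L 0).
have dE (x : R) : is_derive x 1 (fun x => L x - L 0) (gauss_fun x).
  by rewrite -[gauss_fun x]subr0; apply: is_deriveB; exact: is_derive_cst.
split.
- exact: dE.
- move=> x.
  (* Oddness amounts to [L x + L (- x) = 2 L 0], so it suffices that this sum is constant. *)
  have dS (y : R) : is_derive y 1 (fun y : R => L y + L (- y)) 0.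
    have dN := @is_derive1_comp R L -%R y _ _ (dL (- y)) (is_deriveNid y 1).
    have gN : gauss_fun (- y) = gauss_fun y by rewrite /gauss_fun sqrrN.
    by apply: (is_derive_eq (is_deriveD (dL y) dN)); rewrite gN mulrN1 subrr.
  have := is_derive_0_is_cst 0 x dS; rewrite oppr0; lra.
- by rewrite lE; apply: cvgB => //; exact: cvg_cst.
- exists (2 * Num.sqrt pi) => x; rewrite ler_norml.
  have := LB x; have := LB 0 => /andP[? ?] /andP[? ?].
  by apply/andP; split; lra.
Qed.

(* Integration by parts: [x^(2s+2) exp(-x^2)] is [s + 1/2] times
   [x^(2s) exp(-x^2)] plus the derivative of [-x^(2s+1) exp(-x^2) / 2]. *)
Lemma even_monomial_gauss_primitive (R : realType) (s : nat) :
  exists E : R -> R,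
  [/\ forall x : R, is_derive x 1 E (x ^+ (2 * s) * gauss_fun x),
      forall x, E (- x) = - E x,
      E x @[x --> +oo] --> (\prod_(j < s) (j%:R + 2^-1)) * (Num.sqrt pi / 2) &
      exists B : R, forall x, `|E x| <= B].
Proof.
elim: s => [|s [E [dE oE cE [B EB]]]].
  have [E [dE oE cE EB]] := gauss_primitive R; exists E; split => //.
    by move=> x; rewrite muln0 expr0 mul1r.
  by rewrite big_ord0 mul1r.
pose q x : R := x ^+ (2 * s).+1 * gauss_fun x.
have decq : decaying R q by exact: decaying_monomial_gauss.
exists (fun x => (s%:R + 2^-1) * E x - 2^-1 * q x); split.
- move=> x.
  have dq : is_derive x 1 q
      (((2 * s).+1%:R * x ^+ (2 * s) - 2 * x ^+ (2 * s.+1)) * gauss_fun x).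
    have := is_derive_poly_gauss R 'X^((2 * s).+1) x.
    rewrite derivXn /= !hornerE/= hornerMn !hornerXn.
    have -> : (fun x => ('X^((2 * s).+1)).[x] * gauss_fun x) = q.
      by apply/funext => y; rewrite hornerXn.
    by rewrite -mulr_natl mulnS add2n [x ^+ (2 * s).+2]exprS mulrA.
  have := is_deriveB (is_deriveZ (s%:R + 2^-1) (dE x)) (is_deriveZ 2^-1 dq).
  move=> /is_derive_eq; apply; rewrite /GRing.scale/=.
  by rewrite -[(2 * s).+1%:R]natr1 natrM mulnS add2n 2!exprS; field.
- move=> x; rewrite oE /q /gauss_fun sqrrN exprNn exprS exprM sqrrN !expr1n.
  ring.
- rewrite big_ord_recr /= mulrAC -[X in _ --> X]subr0 mulrC; apply: cvgB.
    by apply: cvgM => //; exact: cvg_cst.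
  rewrite -(mulr0 2^-1); apply: cvgM; [exact: cvg_cst|exact: decaying_cvg0].
- have [C qC] := decq.
  exists (`|s%:R + 2^-1| * B + 2^-1 * C) => x.
  rewrite (le_trans (ler_normB _ _))//; apply: lerD.
    by rewrite normrM ler_wpM2l.
  rewrite normrM gtr0_norm ?invr_gt0// ler_wpM2l ?invr_ge0//.
  rewrite (le_trans (qC x))// ler_piMr ?recip1sqr_le1//.
  by have := le_trans (normr_ge0 _) (qC 0); rewrite pmulr_lge0// recip1sqr_gt0.
Qed.

(** * The Gamma function at half-integers *)

Lemma powR_half_integer (R : realType) (u : R) (s : nat) : 0 <= u ->
  u `^ (s%:R + 2^-1) = u ^+ s * Num.sqrt u.
Proof.
move=> u0; rewrite powRD ?powR_mulrn ?powR12_sqrt//.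
by apply/implyP => /eqP; have := ler0n R s; lra.
Qed.

Lemma cvg_sqrt_pinfty (R : realType) : Num.sqrt (x : R) @[x --> +oo] --> +oo.
Proof.
apply/cvgryPge => A; near=> x.
apply: (@le_trans _ _ (Num.sqrt (A ^+ 2))); first by rewrite sqrtr_sqr ler_norm.
rewrite ler_wsqrtr//; near: x; apply: nbhs_pinfty_ge; exact: num_real.
Unshelve. all: by end_near. Qed.

(* Substituting [u = x^2] turns the integrand into [2 x^(2s+2) exp(-x^2)]. *)
Lemma Gamma_half_integer (R : realType) (s : nat) :
  Gamma (s.+1%:R + 2^-1) = \prod_(j < s.+1) (j%:R + 2^-1) * Num.sqrt pi :> R.
Proof.
have [E [dE oE cE _]] := even_monomial_gauss_primitive R s.+1.
pose f (u : R) := u ^+ s * Num.sqrt u * expR (- u).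
have cf : continuous f.
  move=> u; apply: cvgM; last first.
    by apply: continuous_comp; [exact: opp_continuous|exact: continuous_expR].
  by apply: cvgM; [exact: exprn_continuous|exact: sqrt_continuous].
pose F u := 2 * E (Num.sqrt u).
have E0 : E 0 = 0 by have := oE 0; rewrite oppr0; lra.
have dF (u : R) : 0 < u -> is_derive u 1 F (f u).
  move=> u0; have su0 : 0 < Num.sqrt u by rewrite sqrtr_gt0.
  have dE_sqrt :=
    @is_derive1_comp R E Num.sqrt u _ _ (dE _) (is_derive1_sqrt u0).
  have := is_deriveZ 2 dE_sqrt.
  move=> /is_derive_eq; apply.
  rewrite /GRing.scale/= /gauss_fun /f exprM sqr_sqrtr ?(ltW u0)//.
  rewrite exprS -{1}(sqr_sqrtr (ltW u0)); field; exact: lt0r_neq0.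
have cF0 : F u @[u --> 0^'+] --> F 0.
  apply: cvg_at_right_filter; apply: cvgM; first exact: cvg_cst.
  apply: continuous_comp; first exact: sqrt_continuous.
  exact: (derive_continuous _ _ _ dE).
have cFy : F u @[u --> +oo] --> \prod_(j < s.+1) (j%:R + 2^-1) * Num.sqrt pi.
  have -> : \prod_(j < s.+1) (j%:R + 2^-1) * Num.sqrt pi =
    2 * (\prod_(j < s.+1) (j%:R + 2^-1) * (Num.sqrt pi / 2)) :> R by field.
  apply: cvgM; first exact: cvg_cst.
  exact: (cvg_comp _ _ (cvg_sqrt_pinfty R) cE).
have sE : s.+1%:R + 2^-1 - 1 = s%:R + 2^-1 :> R.
  by rewrite -[s.+1%:R]natr1; ring.
rewrite /Gamma sE.
transitivity (\int[@lebesgue_measure R]_(u in `]0, +oo[) f u).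
  apply: eq_Rintegral => u; rewrite inE/= in_itv/= andbT => u0.
  by rewrite powR_half_integer ?(ltW u0).
rewrite /Rintegral integral_itv_obnd_cbnd; last first.
  apply/measurable_EFinP; apply: measurable_funTS.
  exact: continuous_measurable_fun.
rewrite (@ge0_continuous_FTC2y R f F 0
  (\prod_(j < s.+1) (j%:R + 2^-1) * Num.sqrt pi)) //.
- by rewrite -EFinD /F /= sqrtr0 E0 mulr0 subr0.
- by move=> u u0; rewrite !mulr_ge0 ?exprn_ge0 ?sqrtr_ge0 ?expR_ge0.
- exact/continuous_subspaceT.
- by move=> u /dF[].
- by move=> u; rewrite in_itv/= andbT derive1E => /dF[].
Qed.

(** * Trapezoidal sums of even Gaussian moments *)

(** Only [z >= 0] is summed. For [s >= 1] the term at 0 vanishes, so by evenness the sum over all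
    integers is twice the limit in [M]. *)
Definition gauss_moment_sum (R : realType) (s : nat) (h : R) (M : nat) : R :=
  \sum_(z < M) (h * z%:R) ^+ (2 * s) * gauss_fun (h * z%:R).

Lemma cvg_scaled_nat (R : realType) (T : topologicalType) (f : R -> T)
    (F : set_system T) (h : R) : 0 < h ->
  f x @[x --> +oo] --> F -> f (h * M%:R) @[M --> \oo] --> F.
Proof.
move=> h0 fF; apply: (cvg_comp (fun M : nat => h * M%:R) f) fF.
apply/cvgryPge => A; apply: filterS (cvgry_ge (@cvgr_idn R) (A / h)) => M.
by rewrite ler_pdivrMr// mulrC.
Qed.

Lemma is_cvg_gauss_moment_sum (R : realType) (s : nat) (h : R) :
  0 < h -> h <= 1 -> cvgn (gauss_moment_sum R s h).
Proof.
move=> h0 h1; have [C HC] := decaying_monomial_gauss R (2 * s).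
apply: nondecreasing_is_cvgn.
  apply/nondecreasing_seqP => M; rewrite /gauss_moment_sum big_ord_recr lerDl.
  by rewrite mulr_ge0 ?gauss_fun_ge0// exprn_even_ge0// oddM.
have C0 : 0 <= C.
  by have := le_trans (normr_ge0 _) (HC 0); rewrite pmulr_lge0// recip1sqr_gt0.
exists (C * (3 * pi / h)) => _ [M _ <-].
apply: (@le_trans _ _ (\sum_(z < M) C * recip1sqr R (0 + h * z%:R))).
  apply: ler_sum => z _; rewrite add0r; exact: le_trans (ler_norm _) (HC _).
rewrite -mulr_sumr ler_wpM2l// ler_pdivlMr// mulrC; exact: sum_recip1sqr.
Qed.

(** The grid runs from [- (h * M)] to [h * (M - 1)]. Folding it at 0 leaves its first point
    unpaired, hence the extra term. *)
Lemma even_grid_sum (R : realType) (q : R -> R) (h : R) (M : nat) :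
  (forall x, q (- x) = q x) -> q 0 = 0 ->
  \sum_(i < M + M) q (- (h * M%:R) + h * i%:R) =
    2 * \sum_(i < M) q (h * i%:R) + q (h * M%:R).
Proof.
move=> qN q0; rewrite big_split_ord /=.
have -> : \sum_(i < M) q (- (h * M%:R) + h * (M + i)%:R) =
    \sum_(i < M) q (h * i%:R).
  by apply: eq_bigr => i _; rewrite natrD mulrDr addKr.
have -> : \sum_(i < M) q (- (h * M%:R) + h * i%:R) =
    \sum_(i < M) q (h * i.+1%:R).
  rewrite (reindex_inj rev_ord_inj); apply: eq_bigr => i _ /=.
  by rewrite natrB// mulrBr addKr qN.
have : \sum_(i < M.+1) q (h * i%:R) = \sum_(i < M) q (h * i.+1%:R).
  by rewrite big_ord_recl mulr0 q0 add0r.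
rewrite big_ord_recr /= => <-; ring.
Qed.

(** [grid_sum_error] is applied on the grid from [- (h * M)] to [h * M]. As [M] grows its end terms
    vanish, and by oddness the increment [2 E (h * M)] of the primitive tends to the Gamma value. *)
Lemma gauss_moment_sum_asymptotics (R : realType) (s N : nat) :
  exists C, forall h : R, 0 < h -> h <= 1 ->
  `|2 * h * limn (gauss_moment_sum R s.+1 h) - Gamma (s.+1%:R + 2^-1)|
    <= C * h ^+ N.
Proof.
have [E [dE oE cE [B EB]]] := even_monomial_gauss_primitive R s.+1.
pose q (x : R) := x ^+ (2 * s.+1) * gauss_fun x.
pose D (p : {poly R}) := p^`() - 2 *: ('X * p).
pose F k := if k is k'.+1
  then fun x => (iter k' D 'X^(2 * s.+1)).[x] * gauss_fun x else E.
have F1 x : F 1 x = q x by rewrite /F /= hornerXn.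
have dF k (x : R) : is_derive x 1 (F k) (F k.+1 x).
  by case: k => [|k]; [rewrite F1; exact: dE|exact: is_derive_poly_gauss].
have [|C C0 HC] := grid_sum_error R N F B dF _ EB.
  by move=> k; exact: decaying_poly_gauss.
exists C => h h0 h1.
have cm := is_cvg_gauss_moment_sum R s.+1 h h0 h1.
have cq : q (h * M%:R) @[M --> \oo] --> 0.
  by apply: cvg_scaled_nat => //; exact/decaying_cvg0/decaying_monomial_gauss.
have cd : recip1sqr R (h * M%:R) @[M --> \oo] --> 0.
  by apply: cvg_scaled_nat => //; exact: cvg_recip1sqr.
have cEM := cvg_scaled_nat _ _ _ _ h h0 cE.
have cL : h * (2 * gauss_moment_sum R s.+1 h M + q (h * M%:R)) -
    (E (h * M%:R) + E (h * M%:R)) @[M --> \oo] -->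
    2 * h * limn (gauss_moment_sum R s.+1 h) - Gamma (s.+1%:R + 2^-1).
  have -> : 2 * h * limn (gauss_moment_sum R s.+1 h) - Gamma (s.+1%:R + 2^-1) =
    h * (2 * limn (gauss_moment_sum R s.+1 h) + 0) -
    (\prod_(j < s.+1) (j%:R + 2^-1) * (Num.sqrt pi / 2) +
     \prod_(j < s.+1) (j%:R + 2^-1) * (Num.sqrt pi / 2)).
    by rewrite Gamma_half_integer; field.
  apply: cvgB; last exact: cvgD.
  apply: cvgM; first exact: cvg_cst.
  apply: cvgD => //; apply: cvgM => //; exact: cvg_cst.
have cR : C * (h ^+ N + recip1sqr R (h * M%:R) + recip1sqr R (h * M%:R))
    @[M --> \oo] --> C * h ^+ N.
  rewrite -[in X in _ --> X](addr0 (h ^+ N)).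
  rewrite -[in X in _ --> X](addr0 (h ^+ N + 0)).
  apply: cvgM; first exact: cvg_cst.
  by apply: cvgD => //; apply: cvgD => //; exact: cvg_cst.
(* The constant [C] does not depend on [M], so the estimate passes to the limit. *)
apply: (ler_cvg_to (cvg_norm cL) cR); near=> M.
have := HC h (- (h * M%:R)) (M + M)%N h0 h1.
under eq_bigr do rewrite F1.
rewrite even_grid_sum; last 2 first.
- by move=> x; rewrite /q /gauss_fun sqrrN exprM sqrrN -exprM.
- by rewrite /q expr0n mul0r.
rewrite /= (natrD R M M) (mulrDr h M%:R) addKr oE opprK.
by rewrite [recip1sqr R (- _)]/recip1sqr sqrrN.
Unshelve. all: by end_near. Qed.

(** * Multiplicities and the heat trace as a sum of Gaussian moments *)

(** The integers from [k + 1] to [k + 2a + 1] are symmetric about [z = k + a + 1], and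
    [(z - b)(z + b) = z^2 - b^2]. The extra factor [z] on the left completes the term [b = 0]. The
    induction moves to [k + 1], which keeps the centre. All subtractions are exact since
    [b <= a < z]. *)
Lemma falling_factorial_symmetric (k a : nat) :
  ((k + 2 * a + 1)`! * (k + a + 1) =
   k`! * \prod_(b < a.+1) ((k + a + 1) ^ 2 - b ^ 2))%N.
Proof.
elim: a k => [|a IHa] k.
  by rewrite big_ord1 muln0 !addn0 subn0 addn1 factS mulnAC mulnC mulnn.
rewrite big_ord_recr /=.
have := IHa k.+1.
have -> : (k.+1 + a + 1 = k + a.+1 + 1)%N by rewrite addSnnS.
move=> H.
have -> : (k + 2 * a.+1 + 1 = (k.+1 + 2 * a + 1).+1)%N by rewrite mulnS; lia.
rewrite factS -mulnA H factS.
have -> : ((k + a.+1 + 1) ^ 2 - a.+1 ^ 2 = k.+1 * (k.+1 + 2 * a + 1).+1)%N.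
  rewrite subn_sqr; nia.
by rewrite !mulnA; ring.
Qed.

Lemma sphere_mult_prod (R : realType) (alpha k : nat) : (1 <= alpha)%N ->
  sphere_mult R alpha k * ((2 * alpha)`!)%:R =
    2 * \prod_(0 <= b < alpha) ((k + alpha)%:R ^+ 2 - b%:R ^+ 2).
Proof.
case: alpha => [//|a] _.
have f0 n : (n`!)%:R != 0 :> R by rewrite pnatr_eq0 -lt0n fact_gt0.
have -> : \prod_(0 <= b < a.+1) ((k + a.+1)%:R ^+ 2 - b%:R ^+ 2) =
    ((k + 2 * a + 1)`! * (k + a + 1))%:R / (k`!)%:R :> R.
  rewrite falling_factorial_symmetric natrM mulrAC divff// mul1r.
  rewrite natr_prod big_mkord; apply: eq_bigr => b _.
  rewrite natrB ?natrX ?addn1 ?addnS// leq_exp2r// ltnW//.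
  by rewrite (leq_trans (ltn_ord b))// ltnS leq_addl.
(* At [k = 0] the prescribed value 1 agrees with the product because
   [(2 alpha)! = 2 alpha (2 alpha - 1)!]. *)
rewrite /sphere_mult; case: eqP => [->|_].
  rewrite !add0n fact0 divr1 mul1r -natrM; congr (_%:R).
  rewrite mulnS add2n factS !addn1.
  have -> : ((2 * a).+2 = 2 * a.+1)%N by lia.
  by rewrite -mulnA [(a.+1 * _)%N]mulnC.
have -> : (k + 2 * a.+1 - 1 = k + 2 * a + 1)%N by lia.
have -> : (2 * k + 2 * a.+1 = 2 * (k + a + 1))%N by lia.
have := f0 (2 * a.+1)%N; move: ((2 * a.+1)`!%:R : R) => X X0.
by rewrite !natrM; field; rewrite f0 X0.
Qed.

Lemma heat_traceE (R : realType) (alpha : nat) (K : nat -> R) (h : R) :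
  (1 <= alpha)%N ->
  \prod_(0 <= beta < alpha) ('X^2 - (beta%:R ^+ 2)%:P)
    = \sum_(1 <= s < alpha.+1) K s *: 'X^(2 * s) :> {poly R} ->
  0 < h -> h <= 1 ->
  heat_trace alpha (h ^+ 2) =
    expR (alpha%:R ^+ 2 * h ^+ 2) * 2 / ((2 * alpha)`!)%:R *
    \sum_(1 <= s < alpha.+1)
      K s * (h ^+ (2 * s))^-1 * limn (gauss_moment_sum R s h).
Proof.
move=> alpha0 HK h0 h1.
pose c := expR (alpha%:R ^+ 2 * h ^+ 2) * 2 / ((2 * alpha)`!)%:R.
pose P (z : nat) : R := \prod_(0 <= b < alpha) (z%:R ^+ 2 - b%:R ^+ 2).
have f0 : ((2 * alpha)`!)%:R != 0 :> R by rewrite pnatr_eq0 -lt0n fact_gt0.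
have PE z : P z * gauss_fun (h * z%:R) = \sum_(1 <= s < alpha.+1)
    K s * (h ^+ (2 * s))^-1 * ((h * z%:R) ^+ (2 * s) * gauss_fun (h * z%:R)).
  have -> : P z = \sum_(1 <= s < alpha.+1) K s * z%:R ^+ (2 * s).
    have := congr1 (horner^~ z%:R) HK.
    rewrite /= horner_prod horner_sum => HP; transitivity
      (\prod_(0 <= beta < alpha) ('X^2 - (beta%:R ^+ 2)%:P).[z%:R] : R).
      by apply: eq_bigr => b _; rewrite !hornerE.
    by rewrite HP; apply: eq_bigr => s _; rewrite hornerZ hornerXn.
  rewrite mulr_suml; apply: eq_bigr => s _; rewrite exprMn.
  by field; rewrite expf_neq0// gt_eqF.
have termE k : sphere_mult R alpha k *
    expR (- (h ^+ 2 * (k * (k + 2 * alpha))%:R)) =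
    c * (P (k + alpha)%N * gauss_fun (h * (k + alpha)%:R)).
  have -> : sphere_mult R alpha k = 2 * P (k + alpha)%N / ((2 * alpha)`!)%:R.
    by rewrite -sphere_mult_prod// mulfK.
  rewrite /c /gauss_fun.
  have -> : - (h ^+ 2 * (k * (k + 2 * alpha))%:R) =
      alpha%:R ^+ 2 * h ^+ 2 + - (h * (k + alpha)%:R) ^+ 2.
    by rewrite mul2n -addnn natrM !natrD; ring.
  by rewrite expRD; ring.
(* These zeros allow the sum over [z = k + alpha] to start at 0 instead of [alpha]. *)
have P0 z : (z < alpha)%N -> P z = 0.
  move=> za; rewrite /P big_mkord (bigD1 (Ordinal za))//= subrr mul0r//.
have seriesE n : series (fun k => sphere_mult R alpha k *
    expR (- (h ^+ 2 * (k * (k + 2 * alpha))%:R))) n =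
    c * \sum_(1 <= s < alpha.+1)
      K s * (h ^+ (2 * s))^-1 * gauss_moment_sum R s h (n + alpha).
  rewrite /series /= big_mkord.
  rewrite (eq_bigr _ (fun (k : 'I_n) _ => termE k)).
  rewrite -mulr_sumr; congr (c * _).
  transitivity (\sum_(z < alpha + n) P z * gauss_fun (h * z%:R)).
    rewrite [RHS]big_split_ord /= [X in _ = X + _]big1 ?add0r => [|z _].
      by apply: eq_bigr => k _; rewrite addnC.
    by rewrite P0// mul0r.
  rewrite (eq_bigr _ (fun (z : 'I_(alpha + n)) _ => PE z)).
  rewrite exchange_big /= addnC; apply: eq_bigr => s _.
  by rewrite /gauss_moment_sum mulr_sumr.
rewrite /heat_trace; apply/cvg_lim => //.
rewrite (_ : series _ = fun n => c * \sum_(1 <= s < alpha.+1)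
      K s * (h ^+ (2 * s))^-1 * gauss_moment_sum R s h (n + alpha)); last first.
  exact/funext.
apply: cvgM; first exact: cvg_cst.
apply: cvg_big => [|s _]; first exact: add_continuous.
apply: cvgM; first exact: cvg_cst.
rewrite (cvg_shiftn alpha (gauss_moment_sum R s h)).
exact: is_cvg_gauss_moment_sum.
Qed.

(** * Error orders and the expansion of the heat trace *)

(** The bound holds on all of []0, 1]], so errors add and multiply without any tracking of
    neighbourhoods of 0. *)
Definition vanishes_to_order (R : realType) (N : nat) (f : R -> R) : Prop :=
  exists C, forall h, 0 < h -> h <= 1 -> `|f h| <= C * h ^+ N.

Lemma vanishes_to_orderD (R : realType) (N : nat) (f g : R -> R) :
  vanishes_to_order R N f -> vanishes_to_order R N g ->
  vanishes_to_order R N (fun h => f h + g h).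
Proof.
move=> [C fC] [D gD]; exists (C + D) => h h0 h1; rewrite mulrDl.
exact: le_trans (ler_normD _ _) (lerD (fC h h0 h1) (gD h h0 h1)).
Qed.

Lemma vanishes_to_order_sum (R : realType) (N : nat) (r : seq nat)
    (f : nat -> R -> R) : (forall s, s \in r -> vanishes_to_order R N (f s)) ->
  vanishes_to_order R N (fun h => \sum_(s <- r) f s h).
Proof.
elim: r => [|s r IHr] fr.
  by exists 0 => h _ _; rewrite big_nil normr0 mul0r.
have [|C HC] := vanishes_to_orderD _ _ _ _ (fr s (mem_head _ _)) (IHr _).
  by move=> t tr; apply: fr; rewrite in_cons tr orbT.
by exists C => h h0 h1; rewrite big_cons; exact: HC.
Qed.

Lemma vanishes_to_orderM (R : realType) (M N : nat) (f g : R -> R) :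
  vanishes_to_order R M f -> vanishes_to_order R N g ->
  vanishes_to_order R (M + N) (fun h => f h * g h).
Proof.
move=> [C fC] [D gD]; exists (C * D) => h h0 h1; rewrite normrM exprD mulrACA.
by apply: ler_pM => //; [exact: fC|exact: gD].
Qed.

(** The coefficient of [t^n] in the power series of [t^d exp(c t)]. *)
Definition exp_shift_coeff (R : realType) (c : R) (d n : nat) : R :=
  if (d <= n)%N then c ^+ (n - d) / ((n - d)`!)%:R else 0.

Lemma exp_shift_expansion (R : realType) (c : R) (d N : nat) : 0 <= c ->
  vanishes_to_order R N (fun t => t ^+ d * expR (c * t) -
    \sum_(0 <= n < N) exp_shift_coeff R c d n * t ^+ n).
Proof.
(* If [N <= d], all subtracted coefficients are zero and [t^d <= t^N]. Otherwise [t^d] factors out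
   and the exponential is expanded to order [N - d]. *)
move=> c0; have [Nd|/ltnW dN] := leqP N d.
  exists (expR c) => t t0 t1; rewrite big_nat big1 ?subr0; last first.
    move=> n /andP[_ nN]; rewrite /exp_shift_coeff leqNgt (leq_trans nN)//.
    by rewrite mul0r.
  rewrite ger0_norm ?mulr_ge0 ?expR_ge0 ?exprn_ge0 ?(ltW t0)// mulrC.
apply: ler_pM; rewrite ?expR_ge0 ?exprn_ge0 ?(ltW t0)//.
    by rewrite ler_expR ler_piMr.
  by rewrite ler_wiXn2l// ltW.
rewrite -(subnKC dN); set m := (N - d)%N.
exists (c ^+ m * expR c) => t t0 t1.
rewrite big_mkord big_split_ord /= big1 ?add0r => [|i _]; last first.
  by rewrite /exp_shift_coeff leqNgt ltn_ord mul0r.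
have -> : \sum_(i < m) exp_shift_coeff R c d (d + i) * t ^+ (d + i) =
    t ^+ d * \sum_(i < m) c ^+ i / (i`!)%:R * t ^+ i.
  rewrite mulr_sumr; apply: eq_bigr => i _.
  by rewrite /exp_shift_coeff leq_addr addKn exprD mulrCA.
rewrite -mulrBr normrM ger0_norm ?exprn_ge0 ?(ltW t0)// exprD mulrCA.
rewrite ler_wpM2l ?exprn_ge0 ?(ltW t0)//.
pose F k (x : R) := c ^+ k * expR (c * x).
have dF k (x : R) : is_derive x 1 (F k) (F k.+1 x).
  have dc : is_derive x 1 (fun y : R => c * y) (c * 1).
    exact: (is_deriveZ c (is_derive_id x 1)).
  have de := @is_derive1_comp R expR ( *%R c) x _ _ (is_derive_expR _) dc.
  have := is_deriveZ (c ^+ k) de.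
  by move=> /is_derive_eq; apply; rewrite /F exprSr /GRing.scale/=; ring.
have := taylor_remainder R m F 0 t (c ^+ m * expR c) (ltW t0) dF.
rewrite add0r /F expr0 mul1r.
under eq_bigr do rewrite mulr0 expR0 mulr1.
apply=> y /andP[y0 yt]; rewrite ger0_norm ?mulr_ge0 ?expR_ge0 ?exprn_ge0//.
by rewrite ler_wpM2l ?exprn_ge0// ler_expR ler_piMr// (le_trans yt).
Qed.

Lemma vanishes_to_order_ext (R : realType) (N : nat) (f g : R -> R) :
  (forall h, 0 < h -> h <= 1 -> f h = g h) ->
  vanishes_to_order R N f -> vanishes_to_order R N g.
Proof. by move=> fg [C fC]; exists C => h h0 h1; rewrite -fg// fC. Qed.

Lemma vanishes_to_order_cst (R : realType) (c : R) :
  vanishes_to_order R 0 (fun=> c).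
Proof. by exists `|c| => h _ _; rewrite expr0 mulr1. Qed.

(** Up to any power of [t], the heat trace times [t^(alpha + 1/2)] is the sum over [s] of
    [K s * Gamma (s + 1/2) / (2 alpha)!] times [t^(alpha - s) exp(alpha^2 t)]; this is the
    coefficient of [t^n] there. *)
Definition heat_coeff (R : realType) (alpha : nat) (K : nat -> R) (n : nat) :
    R :=
  \sum_(1 <= s < alpha.+1) K s / ((2 * alpha)`!)%:R * Gamma (s%:R + 2^-1) *
    exp_shift_coeff R (alpha%:R ^+ 2) (alpha - s) n.

Lemma heat_trace_expansion (R : realType) (alpha : nat) (K : nat -> R)
    (N : nat) :
  (1 <= alpha)%N ->
  \prod_(0 <= beta < alpha) ('X^2 - (beta%:R ^+ 2)%:P)
    = \sum_(1 <= s < alpha.+1) K s *: 'X^(2 * s) :> {poly R} ->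
  vanishes_to_order R (2 * N) (fun h =>
    h ^+ (2 * alpha + 1) * heat_trace alpha (h ^+ 2) -
    \sum_(0 <= n < N) heat_coeff R alpha K n * (h ^+ 2) ^+ n).
Proof.
move=> alpha0 HK.
pose c s : R := K s / ((2 * alpha)`!)%:R.
pose G s : R := Gamma (s%:R + 2^-1).
pose a2 : R := alpha%:R ^+ 2.
pose m s (h : R) := (h ^+ 2) ^+ (alpha - s) * expR (a2 * h ^+ 2).
pose r s (h : R) := 2 * h * limn (gauss_moment_sum R s h) - G s.
pose d s (h : R) := m s h -
  \sum_(0 <= n < N) exp_shift_coeff R a2 (alpha - s) n * (h ^+ 2) ^+ n.
have a20 : 0 <= a2 by rewrite sqr_ge0.
(* The error of each summand splits in two: [d] truncates the exponential series, and [r] replaces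
   the trapezoidal sum by the integral. Orders are counted in [h], hence [2 * N]. *)
apply: (@vanishes_to_order_ext _ _ (fun h => \sum_(s <- index_iota 1 alpha.+1)
  (c s * G s * d s h + c s * (m s h * r s h)))) => [h h0 h1|].
  rewrite (heat_traceE _ _ K)// mulr_sumr mulr_sumr.
  have -> : \sum_(0 <= n < N) heat_coeff R alpha K n * (h ^+ 2) ^+ n =
      \sum_(1 <= s < alpha.+1) c s * G s *
      \sum_(0 <= n < N) exp_shift_coeff R a2 (alpha - s) n * (h ^+ 2) ^+ n.
    under eq_bigr do rewrite /heat_coeff mulr_suml.
    rewrite exchange_big; apply: eq_bigr => s _; rewrite mulr_sumr.
    by apply: eq_bigr => n _; rewrite -!mulrA.
  rewrite -sumrB; apply: eq_big_nat => s /andP[s1 sa].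
  rewrite /d /r mulrBr mulrBr.
  set S := \sum_(0 <= n < N) _; set l := limn _.
  have -> : h ^+ (2 * alpha + 1) = h * (h ^+ (2 * s) * (h ^+ 2) ^+ (alpha - s)).
    by rewrite -exprM -exprD -exprS; congr (_ ^+ _); lia.
  have h2 : h ^+ (2 * s) != 0 by rewrite expf_neq0// gt_eqF.
  have f0 : ((2 * alpha)`!)%:R != 0 :> R by rewrite pnatr_eq0 -lt0n fact_gt0.
  rewrite /c /m /a2.
  move: (h ^+ (2 * s)) ((2 * alpha)`!%:R : R) h2 f0 => u v u0 v0.
  by field; rewrite u0 v0.
apply: vanishes_to_order_sum => s; rewrite mem_index_iota => /andP[s1 _].
have mO : vanishes_to_order R 0 (m s).
  exists (expR a2) => h h0 h1; rewrite expr0 mulr1 ger0_norm; last first.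
    by rewrite mulr_ge0 ?expR_ge0// exprn_ge0// sqr_ge0.
  have h21 : h ^+ 2 <= 1 by rewrite exprn_ile1// ltW.
  rewrite -[leRHS]mul1r.
  apply: ler_pM; rewrite ?expR_ge0 ?exprn_ge0 ?(ltW h0)//.
    by rewrite exprn_ile1// sqr_ge0.
  by rewrite ler_expR ler_piMr.
apply: vanishes_to_orderD.
- apply: (vanishes_to_orderM _ 0 (2 * N)); first exact: vanishes_to_order_cst.
  have [C HC] := exp_shift_expansion R a2 (alpha - s) N a20.
  exists C => h h0 h1; rewrite exprM; apply: HC; first exact: exprn_gt0.
  by rewrite exprn_ile1// ltW.
- apply: (vanishes_to_orderM _ 0 (2 * N)); first exact: vanishes_to_order_cst.
  apply: (vanishes_to_orderM _ 0 (2 * N)) => //.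
  by case: s s1 {mO} => // s _; exact: gauss_moment_sum_asymptotics.
Qed.

(** * Existence and uniqueness of the heat invariants *)

Lemma heat_scale_sqr (R : realType) (alpha n : nat) (h : R) : 0 < h ->
  heat_scale alpha n (h ^+ 2) = (h ^+ 2) ^+ n / h ^+ (2 * alpha + 1).
Proof.
move=> h0; have h20 : 0 < h ^+ 2 by rewrite exprn_gt0.
rewrite /heat_scale powRD; last by rewrite (gt_eqF h20) implybT.
rewrite powR_mulrn ?ltW// powRN [_%:R / 2]mulrC powRrM powR12_sqrt ?ltW//.
by rewrite sqrtr_sqr gtr0_norm// powR_mulrn ?ltW.
Qed.

Lemma heat_invariants_heat_coeff (R : realType) (alpha : nat) (K : nat -> R) :
  (1 <= alpha)%N ->
  \prod_(0 <= beta < alpha) ('X^2 - (beta%:R ^+ 2)%:P)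
    = \sum_(1 <= s < alpha.+1) K s *: 'X^(2 * s) :> {poly R} ->
  heat_invariants alpha (heat_coeff R alpha K).
Proof.
move=> alpha0 HK N; apply/eqoP => eps eps0.
have [C HC] := heat_trace_expansion R alpha K N.+1 alpha0 HK.
near=> t.
have t0 : 0 < t by near: t; exact: nbhs_right_gt.
have t1 : t <= 1 by near: t; exact: nbhs_right_le.
(* The expansion leaves an error [C t^(N+1)] with a spare factor [t]; this threshold gives
   [C t <= eps], and the [+ 1] keeps the denominator positive. *)
have tC : t <= eps / (`|C| + 1).
  by near: t; apply: nbhs_right_le; rewrite divr_gt0// ltr_wpDl.
pose h := Num.sqrt t.
have h0 : 0 < h by rewrite sqrtr_gt0.
have h1 : h <= 1 by rewrite -sqrtr1 ler_wsqrtr.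
have tE : t = h ^+ 2 by rewrite sqr_sqrtr// ltW.
have hp : 0 < h ^+ (2 * alpha + 1) by rewrite exprn_gt0.
rewrite tE heat_scale_sqr//.
have -> : heat_trace alpha (h ^+ 2) -
    \sum_(0 <= n < N.+1) heat_coeff R alpha K n * heat_scale alpha n (h ^+ 2) =
  (h ^+ (2 * alpha + 1) * heat_trace alpha (h ^+ 2) -
    \sum_(0 <= n < N.+1) heat_coeff R alpha K n * (h ^+ 2) ^+ n) /
    h ^+ (2 * alpha + 1).
  rewrite mulrBl mulrAC divff ?gt_eqF// mul1r mulr_suml.
  by congr (_ - _); apply: eq_bigr => n _; rewrite heat_scale_sqr// mulrA.
rewrite !normrM mulrA ler_wpM2r//.
rewrite (le_trans (HC h h0 h1))// exprM -tE.
rewrite [`|t ^+ N|]ger0_norm ?exprn_ge0 ?(ltW t0)//.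
rewrite exprS mulrA ler_wpM2r ?exprn_ge0 ?(ltW t0)//.
move: tC; rewrite ler_pdivlMr ?ltr_wpDl// => /(le_trans _); apply.
rewrite mulrC ler_wpM2l ?(ltW t0)// (le_trans (ler_norm C))// lerDl ler01.
Unshelve. all: by end_near. Qed.

(** By strong induction the terms below [N] cancel in the difference of the two expansions. What is
    left, [a N - b N] times the scale of index [N], is negligible with respect to that scale, so
    [a N = b N]. *)
Lemma heat_invariants_unique (R : realType) (alpha : nat) (a b : nat -> R) :
  heat_invariants alpha a -> heat_invariants alpha b -> a =1 b.
Proof.
move=> Ha Hb N; elim/ltn_ind: N => N IHN.
have /eqoP oa := Ha N; have /eqoP ob := Hb N.
apply/eqP; rewrite -subr_eq0 -normr_le0; apply/ler_addgt0Pl => e e0.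
have e2 : 0 < e / 2 by rewrite divr_gt0.
pose d (a : nat -> R) t :=
  heat_trace alpha t - \sum_(0 <= n < N.+1) a n * heat_scale alpha n t.
near (0 : R)^'+ => t.
have t0 : 0 < t by near: t; exact: nbhs_right_gt.
have s0 : 0 < heat_scale alpha N t by rewrite powR_gt0.
have ta : `|d a t| <= e / 2 * `|heat_scale alpha N t|.
  by near: t; exact: (oa _ e2).
have tb : `|d b t| <= e / 2 * `|heat_scale alpha N t|.
  by near: t; exact: (ob _ e2).
rewrite addr0 -(ler_pM2r s0) -{1}(gtr0_norm s0) -normrM.
have -> : (a N - b N) * heat_scale alpha N t =
  d b t - d a t.
  rewrite /d !big_nat_recr//=.
  have -> : \sum_(0 <= n < N) b n * heat_scale alpha n t =
      \sum_(0 <= n < N) a n * heat_scale alpha n t.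
    by apply: eq_big_nat => n /andP[_ nN]; rewrite IHN.
  ring.
apply: (le_trans (ler_normB _ _)).
move: ta tb; rewrite (gtr0_norm s0); lra.
Unshelve. all: by end_near. Qed.

(** * Closed forms, in general and in dimensions 5 and 7 *)

Lemma exprz_subn (R : fieldType) (x : R) (n d : nat) : x != 0 ->
  x ^ (n%:Z - d%:Z) = x ^+ n / x ^+ d.
Proof. by move=> x0; rewrite expfzDr// -invr_expz. Qed.

Lemma heat_coeffE (R : realType) (alpha : nat) (K : nat -> R) (n : nat) :
  heat_coeff R alpha K n =
  \sum_(1 <= s < alpha.+1)
    (alpha%:R : R) ^ (2 * n%:Z - 2 * alpha%:Z + 2 * s%:Z)
    * Gamma (s%:R + 2^-1) * K s
    * inv_fact R (n%:Z - alpha%:Z + s%:Z) / ((2 * alpha)`!)%:R.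
Proof.
apply: eq_big_nat => s /andP[_ sa]; rewrite /exp_shift_coeff.
case: leqP => [dn|nd].
  have -> : 2 * n%:Z - 2 * alpha%:Z + 2 * s%:Z = (2 * (n - (alpha - s)))%N.
    by lia.
  have -> : n%:Z - alpha%:Z + s%:Z = (n - (alpha - s))%N by lia.
  by rewrite /= -exprnP exprM; ring.
(* Here [n < alpha - s], so the convention for negative factorials matches the zero coefficient. *)
have -> : n%:Z - alpha%:Z + s%:Z = Negz (alpha - s - n).-1 by lia.
by rewrite /= !mulr0 mul0r.
Qed.

(** The falling factorial vanishes for [n < d], so one formula, polynomial in [n] up to the common
    factor [c^n / n!], covers both cases of the definition. *)
Lemma exp_shift_coeff_ffact (R : realType) (c : R) (d n : nat) : c != 0 ->
  exp_shift_coeff R c d n = c ^+ n / c ^+ d * (n ^_ d)%:R / (n`!)%:R.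
Proof.
move=> c0; rewrite /exp_shift_coeff; case: leqP => [dn|nd]; last first.
  by rewrite ffact_small// mulr0 mul0r.
have f0 m : (m`!)%:R != 0 :> R by rewrite pnatr_eq0 -lt0n fact_gt0.
have cE : c ^+ n = c ^+ (n - d) * c ^+ d by rewrite -exprD subnK.
rewrite -(ffact_fact dn) cE natrM mulfK ?expf_neq0//.
have : (n ^_ d)%:R != 0 :> R by rewrite pnatr_eq0 -lt0n ffact_gt0.
move: ((n ^_ d)%:R : R) ((n - d)`!%:R : R) (f0 (n - d)%N) => x y y0 x0.
by field; rewrite x0 y0.
Qed.

(** The constants are read off [X^2 (X^2 - 1) = X^4 - X^2]. *)
Lemma heat_coeff2 (R : realType) (n : nat) :
  heat_coeff R 2 (fun s => if s == 1%N then -1 else 1) n =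
  (4 : R) ^ (n%:Z - 3) * (6 - n%:R) * Num.sqrt pi / (3 * (n`!)%:R).
Proof.
have f0 : (n`!)%:R != 0 :> R by rewrite pnatr_eq0 -lt0n fact_gt0.
rewrite /heat_coeff; do 2 rewrite big_ltn//; rewrite big_geq//= addr0.
rewrite !Gamma_half_integer !big_ord_recr big_ord0 /= mul1r.
rewrite exprz_subn// -natrX !exp_shift_coeff_ffact// ffactn0 ffactn1.
rewrite (_ : (2 * 2)`! = 24)%N//.
move: (n`!%:R : R) f0 (4 ^+ n : R) (Num.sqrt pi) => f f0 p q.
by field; rewrite f0.
Qed.

(** The constants are read off [X^2 (X^2 - 1)(X^2 - 4) = X^6 - 5 X^4 + 4 X^2]. *)
Lemma heat_coeff3 (R : realType) (n : nat) :
  heat_coeff R 3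
    (fun s => if s == 1%N then 4 else if s == 2%N then -5 else 1) n =
  (3 : R) ^ (2 * n%:Z - 6) * (16 * n%:R ^+ 2 - 286 * n%:R + 1215) *
    Num.sqrt pi / (640 * (n`!)%:R).
Proof.
have f0 : (n`!)%:R != 0 :> R by rewrite pnatr_eq0 -lt0n fact_gt0.
have n2 : (n ^_ 2)%:R = n%:R * (n%:R - 1) :> R.
  case: n {f0} => [|n]; first by rewrite mul0r.
  by rewrite ffactSS ffactn1 natrM -[n.+1%:R]natr1 addrK.
rewrite /heat_coeff; do 3 rewrite big_ltn//; rewrite big_geq//= addr0.
rewrite !Gamma_half_integer !big_ord_recr big_ord0 /= mul1r.
rewrite -PoszM exprz_subn// (exprM _ 2 n) !exp_shift_coeff_ffact ?expf_neq0//.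
rewrite ffactn0 ffactn1 n2 (_ : (2 * 3)`! = 720)%N//.
move: (n`!%:R : R) f0 (Num.sqrt pi) ((3 ^+ 2) ^+ n : R) => f f0 q p.
by field; rewrite f0.
Qed.

Theorem theorem1p4 (R : realType) :
  (forall (alpha : nat) (K : nat -> R),
     (1 <= alpha)%N ->
     \prod_(0 <= beta < alpha) ('X^2 - (beta%:R ^+ 2)%:P)
       = \sum_(1 <= s < alpha.+1) K s *: 'X^(2 * s) :> {poly R} ->
     (exists a : nat -> R, heat_invariants alpha a)
     /\ forall a : nat -> R, heat_invariants alpha a ->
        forall n : nat,
          a n = \sum_(1 <= s < alpha.+1)
                  (alpha%:R : R) ^ (2 * n%:Z - 2 * alpha%:Z + 2 * s%:Z)
                  * Gamma (s%:R + 2^-1) * K s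
                  * inv_fact R (n%:Z - alpha%:Z + s%:Z) / ((2 * alpha)`!)%:R)
  /\ (forall a : nat -> R, heat_invariants 2 a ->
      forall n : nat,
        a n = (4 : R) ^ (n%:Z - 3) * (6 - n%:R) * Num.sqrt pi
              / (3 * (n`!)%:R))
  /\ (forall a : nat -> R, heat_invariants 3 a ->
      forall n : nat,
        a n = (3 : R) ^ (2 * n%:Z - 6)
              * (16 * n%:R ^+ 2 - 286 * n%:R + 1215) * Num.sqrt pi
              / (640 * (n`!)%:R)).
Proof.
split; [move=> alpha K alpha0 HK | split=> a Ha n].
- have HC := heat_invariants_heat_coeff R alpha K alpha0 HK.
  split; first by exists (heat_coeff R alpha K).
  by move=> a Ha n; rewrite (heat_invariants_unique _ _ _ _ Ha HC) heat_coeffE.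
- rewrite -heat_coeff2.
  apply: (heat_invariants_unique _ _ _ _ Ha).
  apply: heat_invariants_heat_coeff => //.
  do 2 rewrite big_ltn//; rewrite big_geq// mulr1.
  do 2 rewrite big_ltn//; rewrite big_geq// addr0 /= scaleN1r scale1r.
  rewrite expr0n expr1n polyC0 polyC1; ring.
- rewrite -heat_coeff3.
  apply: (heat_invariants_unique _ _ _ _ Ha).
  apply: heat_invariants_heat_coeff => //.
  do 3 rewrite big_ltn//; rewrite big_geq// mulr1.
  do 3 rewrite big_ltn//; rewrite big_geq// addr0 /= scale1r.
  rewrite expr0n expr1n polyC0 polyC1 -!mul_polyC -natrX polyCN !polyC_natr.
  ring.
Qed.
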